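(* Let $A$ and $B_0,B_1,\dots$ be real SPD matrices of the same size, and let $\kappa_{\max}$ be a constant such that $\kappa(B_k^{-1}A)\le\kappa_{\max}$ for all $k$. Let $\{m_k\}$ be integers with $0\le m_k\le k$ and $m_{k+1}\le m_k+1$ for all $k$. Then for the method described in the context, with any $b$ and $x_0$, for every $k\geq 0$ such that the exact solution has not been obtained before or at step $k$ (i.e. $x_j\neq x$ for $0\le j\le k$), $$\frac{\|e_{k+1}\|_A}{\|e_k\|_A}\le\frac{\kappa_{\max}-1}{\kappa_{\max}+1}.$$
   Context: SPD means real symmetric positive definite. $(\cdot,\cdot)$ is the standard inner product, $(x,y)_A=(x,Ay)$ and $\|x\|_A=\sqrt{(x,x)_A}$. For SPD $A$ and $B$, the eigenvalues of $B^{-1}A$ are real positive and $\kappa(B^{-1}A)=\lambda_{\max}(B^{-1}A)/\lambda_{\min}(B^{-1}A)$. The method: given $A$, $b$, preconditioners $\{B_k\}$, integers $\{m_k\}$ and an initial guess $x_0$, for $k=0,1,\dots$ compute $r_k=b-Ax_k$, $s_k=B_k^{-1}r_k$, and $$p_k=s_k-\sum_{l=k-m_k}^{k-1}\frac{(As_k,p_l)}{(Ap_l,p_l)}p_l,\qquad x_{k+1}=x_k+\frac{(r_k,p_k)}{(Ap_k,p_k)}p_k .$$ The error is $e_k=x-x_k$, where $x=A^{-1}b$. *)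

(* Defs.v *)
From HB Require Import structures.
From mathcomp Require Import all_boot all_order all_algebra.
From mathcomp Require Import boolp classical_sets reals.
Set Implicit Arguments.
Unset Strict Implicit.
Unset Printing Implicit Defensive.
Import Order.TTheory GRing.Theory Num.Theory.
Local Open Scope ring_scope.
Local Open Scope classical_set_scope.

Section Preconditioning.
Variables (R : realType) (n : nat).
Implicit Types (A M : 'M[R]_n) (x y : 'cV[R]_n).

Definition dot x y : R := (x^T *m y) 0 0.
Definition dotA A x y : R := dot x (A *m y).
Definition normA A x : R := Num.sqrt (dotA A x x).

Definition spd A : Prop :=
  A \is symmetricmx /\ forall x, x != 0 -> 0 < dot x (A *m x).

(* [eigenvalue] refers to left eigenvectors (u *m M = a *: u), which for a
   square matrix gives the usual spectrum.  The default value 0 is returned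
   only when M has no eigenvalue in R; for M = B^-1 A with A, B SPD this
   happens only if n = 0. *)
Definition lambda_max M : R :=
  xget 0 [set a | eigenvalue M a /\ forall b, eigenvalue M b -> b <= a].
Definition lambda_min M : R :=
  xget 0 [set a | eigenvalue M a /\ forall b, eigenvalue M b -> a <= b].
Definition cond_number M : R := lambda_max M / lambda_min M.

(* The sequences are indexed by all of nat: by the convention 0^-1 = 0 the
   recurrences still make sense after the exact solution has been reached, and
   they determine r, s, p and x uniquely from A, b, B, m and x0. *)
Record pcg A (b : 'cV[R]_n) (B : nat -> 'M[R]_n) (m : nat -> nat)
    (x0 : 'cV[R]_n) (x r s p : nat -> 'cV[R]_n) : Prop := Pcg {
  pcg_init : x 0 = x0;
  pcg_residual : forall k, r k = b - A *m x k;
  pcg_precond : forall k, s k = invmx (B k) *m r k;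
  pcg_direction : forall k, p k = s k -
    \sum_(k - m k <= l < k)
       (dot (A *m s k) (p l) / dot (A *m p l) (p l)) *: p l;
  pcg_update : forall k, x k.+1 = x k +
    (dot (r k) (p k) / dot (A *m p k) (p k)) *: p k
}.

End Preconditioning.

(* Main.v *)
Require Import Defs.
From mathcomp Require Import all_boot all_order all_algebra.
From mathcomp Require Import boolp classical_sets reals.
From mathcomp Require Import ring lra zify.
Set Implicit Arguments.
Unset Strict Implicit.
Unset Printing Implicit Defensive.
Import Order.TTheory GRing.Theory Num.Theory.
Local Open Scope ring_scope.

(** Write [e] for the error before step [k] and [M] for the preconditioned
    matrix [B_k^-1 A].  The residual is [A e], so the preconditioned residual
    is [s = M e].

    The step is never worse than preconditioned steepest descent.  Because the
    windows of retained directions satisfy [m_{k+1} <= m_k + 1], a window only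
    ever gains the newest direction, so mutual A-conjugacy inside it is
    preserved by induction ([directions_conjugate]), and so is the
    A-orthogonality of the error to it ([residual_orthogonal]).  Now [s = p + q]
    with [q] in the span of the window; as [q] is A-orthogonal both to [e] and
    to [p], moving by [t p] leaves at most the energy left by moving by [t s]
    ([conjugate_direction_better]), and the exact line search is optimal along
    [p] ([exact_line_search]).  Hence the new error is no larger in energy than
    [e - t s = (1 - t M) e] for any [t]
    ([error_energy_descent]).

    It remains to bound [1 - t M] for one good [t].  The matrix [M] is
    self-adjoint for the A-inner product; let [a] and [b] be its extreme
    eigenvalues.  They exist and bound the Rayleigh quotient ([rayleigh_min],
    [rayleigh_max]).  For [t = 2 / (a + b)] the quadratic form of [1 - t M] lies
    between [- rho] and [rho] times the energy, with [rho = (b - a) / (b + a)],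
    and polarization turns this into a bound on the operator norm
    ([selfadjoint_contraction]).  Finally [rho = (kappa - 1) / (kappa + 1)] for
    [kappa = b / a], and this is increasing in [kappa].

    The extreme eigenvalues are obtained without a spectral theorem: the
    supremum [a] of the shifts that keep [A (M - a)] positive semidefinite must
    make it singular, since a nonsingular semidefinite matrix is coercive and
    would allow a slightly larger shift. *)

(** * Bilinear forms of symmetric matrices *)

Section Forms.
Variables (R : realType) (n : nat).
Implicit Types (A G K L M N : 'M[R]_n) (x y z u v e p q s : 'cV[R]_n).

Lemma dotC x y : dot x y = dot y x.
Proof. by rewrite /dot -[x^T *m y]trmxK mxE trmx_mul trmxK. Qed.

Lemma dotDl x y z : dot (x + y) z = dot x z + dot y z.
Proof. by rewrite /dot linearD mulmxDl mxE. Qed.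

Lemma dotZl t x z : dot (t *: x) z = t * dot x z.
Proof. by rewrite /dot linearZ -scalemxAl mxE. Qed.

Lemma dot0l x : dot 0 x = 0.
Proof. by rewrite -(scale0r x) dotZl mul0r. Qed.

Lemma dotE x y : dot x y = \sum_i x i 0 * y i 0.
Proof. by rewrite /dot mxE; apply: eq_bigr => i _; rewrite mxE. Qed.

Lemma dot_adj K x y : dot (K *m x) y = dot x (K^T *m y).
Proof. by rewrite /dot trmx_mul mulmxA. Qed.

Lemma spdP K : spd K <-> K^T = K /\ forall x, x != 0 -> 0 < dotA K x x.
Proof.
have symE : (K \is symmetricmx) <-> K^T = K.
  rewrite is_hermitianmxE expr0 scale1r; split=> [/eqP KE|KE].
    by rewrite {2}KE; apply/matrixP=> i j; rewrite !mxE.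
  by apply/eqP; rewrite -{1}KE; apply/matrixP=> i j; rewrite !mxE.
by split=> -[/symE ? ?].
Qed.

Lemma dotADl K x y z : dotA K (x + y) z = dotA K x z + dotA K y z.
Proof. exact: dotDl. Qed.

Lemma dotAZl K t x z : dotA K (t *: x) z = t * dotA K x z.
Proof. exact: dotZl. Qed.

Lemma dotADr K x y z : dotA K x (y + z) = dotA K x y + dotA K x z.
Proof. by rewrite /dotA mulmxDr dotC dotDl !(dotC x). Qed.

Lemma dotAZr K t x y : dotA K x (t *: y) = t * dotA K x y.
Proof. by rewrite /dotA -scalemxAr dotC dotZl dotC. Qed.

Lemma dotABr K x y z : dotA K x (y - z) = dotA K x y - dotA K x z.
Proof. by rewrite dotADr -[- z]scaleN1r dotAZr mulN1r. Qed.

Lemma dotA0l K x : dotA K 0 x = 0.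
Proof. exact: dot0l. Qed.

Lemma dotA0r K x : dotA K x 0 = 0.
Proof. by rewrite -(scale0r x) dotAZr mul0r. Qed.

Lemma dotA_sumr K x (I : Type) (t : seq I) (P : pred I) (F : I -> 'cV[R]_n) :
  dotA K x (\sum_(i <- t | P i) F i) = \sum_(i <- t | P i) dotA K x (F i).
Proof.
elim/big_rec2: _ => [|i a y _ <-]; last by rewrite dotADr.
by rewrite dotA0r.
Qed.

Lemma dotAC K x y : K^T = K -> dotA K x y = dotA K y x.
Proof. by move=> KE; rewrite /dotA -{1}KE -dot_adj dotC. Qed.

Lemma dotAZm K t x y : dotA (t *: K) x y = t * dotA K x y.
Proof. by rewrite /dotA -scalemxAl dotC dotZl dotC. Qed.

Lemma dotA_mul K M x y : dotA (K *m M) x y = dotA K x (M *m y).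
Proof. by rewrite /dotA mulmxA. Qed.

Lemma dotA_subZ K x y t : K^T = K ->
  dotA K (x - t *: y) (x - t *: y) =
    dotA K x x - 2 * t * dotA K x y + t ^+ 2 * dotA K y y.
Proof.
move=> KE; rewrite -scaleNr !dotADl !dotADr !dotAZl !dotAZr (dotAC y x KE).
ring.
Qed.

Lemma spd_ge0 K x : spd K -> 0 <= dotA K x x.
Proof.
move=> /spdP[_ Kpos]; have [->|/Kpos/ltW//] := eqVneq x 0.
by rewrite dotA0l.
Qed.

(** Semidefiniteness suffices; this is what later identifies the isotropic
    vectors of a semidefinite form with its kernel. *)
Lemma cauchy_schwarz K x y : K^T = K -> (forall z, 0 <= dotA K z z) ->
  dotA K x y ^+ 2 <= dotA K x x * dotA K y y.
Proof.
move=> KE psd; have H t : 0 <= dotA K x x - 2 * t * dotA K x y + t ^+ 2 * dotA K y y.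
  by rewrite -dotA_subZ.
have [yy0|yyN0] := eqVneq (dotA K y y) 0.
  suff -> : dotA K x y = 0 by rewrite expr2 mul0r yy0 mulr0.
  apply/eqP; apply/negP=> /negP xyN0.
  (* With [dotA K y y = 0] the quadratic is affine in [t]; this [t] makes it -1. *)
  have := H ((dotA K x x + 1) / (2 * dotA K x y)).
  rewrite yy0 mulr0 addr0 (_ : _ - _ = -1); last by field.
  lra.
have yy : 0 < dotA K y y by rewrite lt_neqAle eq_sym yyN0 psd.
(* The minimizer of the quadratic in [t]. *)
have := H (dotA K x y / dotA K y y).
rewrite -(pmulr_lge0 _ yy).
rewrite (_ : (_ + _) * _ = dotA K x x * dotA K y y - dotA K x y ^+ 2).
  by rewrite subr_ge0.
by field.
Qed.

Lemma dot_ge0 x : 0 <= dot x x.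
Proof. by rewrite dotE sumr_ge0 // => i _; rewrite -expr2 sqr_ge0. Qed.

Lemma dot_eq0 x : (dot x x == 0) = (x == 0).
Proof.
apply/eqP/eqP => [|->]; last by rewrite dot0l.
rewrite dotE => /eqP; rewrite psumr_eq0 => [|i _]; last by rewrite -expr2 sqr_ge0.
move=> /allP x0; apply/matrixP=> i j; rewrite ord1 !mxE.
by have /eqP := x0 i (mem_index_enum i); move/eqP; rewrite -expr2 sqrf_eq0 => /eqP.
Qed.

(** Crude entrywise bound, from [`|x_i x_j| <= |x|^2]; the summand [1] makes the
    constant strictly positive so that one can divide by it. *)
Lemma form_bounded K :
  exists2 C, 0 < C & forall x, dotA K x x <= C * dot x x.
Proof.
exists (1 + \sum_i \sum_j `|K i j|) => [|x].
  by rewrite ltr_pwDl // sumr_ge0 // => i _; rewrite sumr_ge0.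
rewrite mulrDl mul1r ler_wpDl ?dot_ge0 // /dotA dotE mulr_suml ler_sum // => i _.
rewrite mxE mulr_sumr mulr_suml ler_sum // => j _.
have xi_le k : x k 0 ^+ 2 <= dot x x.
  rewrite dotE (bigD1 k) //= -expr2 lerDl sumr_ge0 // => l _.
  by rewrite -expr2 sqr_ge0.
have := xi_le i; have := xi_le j.
move: (x i 0) (x j 0) (dot x x) => a b d aL bL.
rewrite mulrCA; apply: le_trans (ler_norm _) _; rewrite normrM.
apply: ler_wpM2l => //; rewrite ler_norml; apply/andP; split.
  have := sqr_ge0 (a + b); nra.
have := sqr_ge0 (a - b); nra.
Qed.

Lemma spd_unitmx K : spd K -> K \in unitmx.
Proof.
move=> /spdP[KE Kpos]; rewrite -row_free_unit -kermx_eq0.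
apply/negPn/negP=> /rowV0Pn[u /sub_kermxP uK0 uN0].
have := Kpos u^T; rewrite -(inj_eq (@trmx_inj _ _ _)) trmxK trmx0 => /(_ uN0).
by rewrite /dotA -{1}KE -trmx_mul uK0 trmx0 /dot mulmx0 mxE ltxx.
Qed.

(** If [dotA K x x = 0], Cauchy-Schwarz against [K x] gives [|K x|^2 = 0]. *)
Lemma psd_unitmx_spd K : K^T = K -> (forall x, 0 <= dotA K x x) ->
  K \in unitmx -> spd K.
Proof.
move=> KE psd Ku; apply/spdP; split=> // x; apply: contraNT.
rewrite lt_neqAle psd andbT negbK eq_sym => /eqP xx0.
suff : K *m x = 0 by move/(congr1 (mulmx (invmx K))); rewrite mulKmx // mulmx0 => ->.
apply/eqP; rewrite -dot_eq0 -sqrf_eq0 -[dot _ _]/(dotA K (K *m x) x).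
rewrite eq_le sqr_ge0 andbT.
by have := cauchy_schwarz (K *m x) x KE psd; rewrite xx0 mulr0.
Qed.

(** Cauchy-Schwarz for [K] applied to [x] and [K^-1 x] reads
    [|x|^4 <= (x, K x) (x, K^-1 x)], and the last factor is at most [C |x|^2].
    This replaces a compactness argument on the unit sphere. *)
Lemma spd_coercive K : spd K ->
  exists2 c, 0 < c & forall x, c * dot x x <= dotA K x x.
Proof.
move=> Kspd; have Ku := spd_unitmx Kspd; have [KE _] := (spdP K).1 Kspd.
have [C C0 Cb] := form_bounded (invmx K).
exists C^-1 => [|x]; first by rewrite invr_gt0.
rewrite ler_pdivrMl //; have [->|xN0] := eqVneq x 0.
  by rewrite dot0l dotA0l mulr0.
have xx : 0 < dot x x by rewrite lt_neqAle eq_sym dot_eq0 xN0 dot_ge0.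
have KKx : K *m (invmx K *m x) = x by rewrite mulKVmx.
have := cauchy_schwarz x (invmx K *m x) KE (fun z => spd_ge0 z Kspd).
rewrite {1 3}/dotA KKx (dotC (invmx K *m x)) => CS.
rewrite -(ler_pM2r xx); apply: le_trans (_ : dotA K x x * dotA (invmx K) x x <= _).
  by rewrite -expr2.
by rewrite [C * _]mulrC -mulrA ler_wpM2l ?spd_ge0 // Cb.
Qed.
End Forms.

(** * Extreme eigenvalues and contraction *)

Section Spectrum.
Variables (R : realType) (n : nat).
Implicit Types (A G K L M N : 'M[R]_n) (x y z u v e p q s : 'cV[R]_n).

Lemma eigenvalue_unitmx M a : eigenvalue M a = (M - a%:M \notin unitmx).
Proof. by rewrite -row_free_unit -kermx_eq0. Qed.

(** [eigenvalue] speaks of row eigenvectors; singularity of [M - a%:M] transfers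
    them to columns. *)
Lemma eigenvalue_colP M a :
  eigenvalue M a -> exists2 v : 'cV[R]_n, v != 0 & M *m v = a *: v.
Proof.
rewrite eigenvalue_unitmx -unitmx_tr -row_free_unit -kermx_eq0.
case/rowV0Pn=> u /sub_kermxP uM uN0; exists u^T.
  by apply: contraNneq uN0 => /(congr1 trmx); rewrite trmxK trmx0 => ->.
apply/eqP; rewrite -subr_eq0 -mul_scalar_mx -mulmxBl.
by rewrite -(trmxK (M - _)) -trmx_mul uM trmx0.
Qed.

Lemma eigenvalueN M a : eigenvalue (- M) a = eigenvalue M (- a).
Proof.
apply/eigenvalueP/eigenvalueP => -[u Mu uN0]; exists u => //.
  by rewrite scaleNr -Mu mulmxN opprK.
by rewrite mulmxN Mu scaleNr opprK.
Qed.

(** The least eigenvalue is the supremum [a] of all lower bounds of the Rayleigh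
    quotient.  If [G (M - a)] were nonsingular, it would be coercive, hence
    bounded below by a positive multiple of [G], and [a] could be increased.
    The vector [v0] only witnesses that the space is nonzero. *)
Lemma rayleigh_min G M v0 : v0 != 0 -> spd G -> (G *m M)^T = G *m M ->
  exists a, [/\ eigenvalue M a, forall b, eigenvalue M b -> a <= b
             & forall x, a * dotA G x x <= dotA G x (M *m x)].
Proof.
move=> v0N0 Gspd GM; have [GE Gpos] := (spdP G).1 Gspd.
pose E : set R := [set a | forall x, a * dotA G x x <= dotA G x (M *m x)]%classic.
have [c c0 Gc] := spd_coercive Gspd.
have E0 : (E !=set0)%classic.
  have [C C0 Cb] := form_bounded (- (G *m M)).
  exists (- (C / c)) => x; rewrite -dotA_mul mulNr lerNl.
  rewrite -mulN1r -dotAZm scaleN1r; apply: le_trans (Cb x) _.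
  by rewrite -mulrA ler_pM2l // ler_pdivlMl.
have Eub : has_ubound E.
  exists (dotA G v0 (M *m v0) / dotA G v0 v0) => a Ea.
  by rewrite ler_pdivlMr ?Gpos.
pose a := sup E.
have Ea x : a * dotA G x x <= dotA G x (M *m x).
  have [->|xN0] := eqVneq x 0; first by rewrite !dotA0l mulr0.
  rewrite -ler_pdivlMr ?Gpos //; apply: ge_sup => // b Eb.
  by rewrite ler_pdivlMr ?Gpos.
exists a; split=> // [|b /eigenvalue_colP[v vN0 Mv]]; last first.
  by rewrite -(ler_pM2r (Gpos v vN0)); have := Ea v; rewrite Mv dotAZr.
rewrite eigenvalue_unitmx; apply/negP=> Mu.
pose K := G *m (M - a%:M).
have KE : K^T = K by rewrite /K mulmxBr mul_mx_scalar linearB linearZ /= GM GE.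
have Kform x : dotA K x x = dotA G x (M *m x) - a * dotA G x x.
  by rewrite dotA_mul mulmxBl mul_scalar_mx dotABr dotAZr.
have Kspd : spd K.
  apply: psd_unitmx_spd => // [x|]; first by rewrite Kform subr_ge0.
  by rewrite unitmx_mul spd_unitmx.
have [d d0 Kd] := spd_coercive Kspd; have [C C0 Cb] := form_bounded G.
suff /(ub_le_sup Eub) : E (a + d / C).
  by rewrite -/a gerDl leNgt divr_gt0.
move=> x; rewrite mulrDl -lerBrDl -Kform; apply: le_trans (Kd x).
by rewrite -mulrA ler_pM2l // ler_pdivrMl.
Qed.

Lemma rayleigh_max G M v0 : v0 != 0 -> spd G -> (G *m M)^T = G *m M ->
  exists b, [/\ eigenvalue M b, forall a, eigenvalue M a -> a <= b
             & forall x, dotA G x (M *m x) <= b * dotA G x x].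
Proof.
move=> v0N0 Gspd GM.
have [|a [Ma amin ale]] := rayleigh_min (M := - M) v0N0 Gspd.
  by rewrite mulmxN linearN /= GM.
exists (- a); split=> [|c Mc|x]; first by rewrite -eigenvalueN.
  by rewrite lerNr amin // eigenvalueN opprK.
by rewrite mulNr lerNr; have := ale x; rewrite mulNmx -scaleN1r dotAZr mulN1r.
Qed.

Lemma lambda_minE M a : eigenvalue M a ->
  (forall b, eigenvalue M b -> a <= b) -> lambda_min M = a.
Proof.
move=> Ma amin; apply: xget_unique => // c [Mc cmin].
by apply: le_anti; rewrite cmin // amin.
Qed.

Lemma lambda_maxE M b : eigenvalue M b ->
  (forall a, eigenvalue M a -> a <= b) -> lambda_max M = b.
Proof.
move=> Mb bmax; apply: xget_unique => // c [Mc cmax].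
by apply: le_anti; rewrite cmax // bmax.
Qed.

(** The norm of a self-adjoint operator is governed by its quadratic form.
    Subtracting the bounds at [u + v] and [u - v] and using the parallelogram
    law bounds [2 (v, N u)] by [rho (|u|^2 + |v|^2)]; the choice [u = rho x] and
    [v = N x] then balances both sides. *)
Lemma selfadjoint_contraction G N rho x : spd G -> (G *m N)^T = G *m N ->
  0 <= rho -> (forall z, `|dotA G z (N *m z)| <= rho * dotA G z z) ->
  dotA G (N *m x) (N *m x) <= rho ^+ 2 * dotA G x x.
Proof.
move=> Gspd GN rho0 Nb; have [GE _] := (spdP G).1 Gspd.
have polar u v : 2 * dotA G v (N *m u) <= rho * (dotA G u u + dotA G v v).
  (* The factor [1] brings [u - v] into the shape of [dotA_subZ]. *)
  have := Nb (u + v); have := Nb (u - 1 *: v).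
  rewrite -!(dotA_mul G N) !dotA_subZ // !(dotADl, dotADr).
  rewrite (dotAC u v GE) (dotAC u v GN).
  rewrite !ler_norml => /andP[H1 _] /andP[_ H2].
  lra.
have NN0 := spd_ge0 (N *m x) Gspd; have xx0 := spd_ge0 x Gspd.
have [rho_eq0|rhoN0] := eqVneq rho 0.
  have := polar x (N *m x); rewrite rho_eq0; nra.
have rho_gt0 : 0 < rho by rewrite lt_neqAle eq_sym rhoN0.
have := polar (rho *: x) (N *m x).
rewrite -scalemxAr !dotAZl !dotAZr => H.
rewrite -(ler_pM2l rho_gt0); nra.
Qed.

(** The step length [2 / (a + b)] centres the spectrum of [1 - t M] at zero: its
    extreme values there are [(b - a) / (b + a)] and the opposite. *)
Lemma preconditioned_step_contraction A B e : spd A -> spd B -> e != 0 ->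
  exists t rho, [/\ 1 <= cond_number (invmx B *m A),
    rho = (cond_number (invmx B *m A) - 1) / (cond_number (invmx B *m A) + 1)
  & dotA A (e - t *: (invmx B *m A *m e)) (e - t *: (invmx B *m A *m e))
      <= rho ^+ 2 * dotA A e e].
Proof.
move=> Aspd Bspd eN0; have [AE Apos] := (spdP A).1 Aspd.
have [BE Bpos] := (spdP B).1 Bspd; have Bu := spd_unitmx Bspd.
set M := invmx B *m A.
have AM : (A *m M)^T = A *m M by rewrite /M !trmx_mul trmx_inv AE BE mulmxA.
have [a [Ma amin aray]] := rayleigh_min eN0 Aspd AM.
have [b [Mb bmax bray]] := rayleigh_max eN0 Aspd AM.
have a0 : 0 < a.
  have [v vN0 Mv] := eigenvalue_colP Ma.
  have : A *m v = a *: (B *m v) by rewrite scalemxAr -Mv mulmxA mulKVmx.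
  move/(congr1 (dot v)); rewrite -[LHS]/(dotA A v v) dotC dotZl dotC => vE.
  by have := Apos v vN0; rewrite vE pmulr_lgt0 // Bpos.
have ab : a <= b by apply: amin.
rewrite /cond_number (lambda_minE Ma amin) (lambda_maxE Mb bmax).
exists (2 / (a + b)), ((b - a) / (b + a)); split.
- by rewrite ler_pdivlMr ?mul1r.
- by field; apply/andP; split; apply/eqP; lra.
rewrite scalemxAl -{1 3}(mul1mx e) -mulmxBl.
apply: selfadjoint_contraction => //.
- by rewrite mulmxBr mulmx1 -scalemxAr linearB linearZ /= AE AM.
- by apply: divr_ge0; lra.
move=> z; rewrite mulmxBl mul1mx -scalemxAl dotABr dotAZr.
have := aray z; have := bray z.
move: (dotA A z z) (dotA A z (M *m z)) => zz zMz Hb Ha.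
have ba0 : 0 < b + a by lra.
rewrite -(ler_pM2l ba0) -{1}(gtr0_norm ba0) -normrM.
rewrite [X in `|X|](_ : _ = (b + a) * zz - 2 * zMz); last by field; apply/eqP; lra.
rewrite [X in _ <= X](_ : _ = (b - a) * zz); last by field; apply/eqP; lra.
rewrite ler_norml; lra.
Qed.
End Spectrum.

(** * Energy decrease along a direction *)

Section Descent.
Variables (R : realType) (n : nat) (A : 'M[R]_n).
Hypothesis spdA : spd A.
Implicit Types (e p q s : 'cV[R]_n).

Lemma exact_line_search e p t (a := dotA A e p / dotA A p p) :
  dotA A (e - a *: p) (e - a *: p) <= dotA A (e - t *: p) (e - t *: p).
Proof.
have [AE Apos] := (spdP A).1 spdA.
rewrite {}/a; have [->|/Apos pp] := eqVneq p 0; first by rewrite !scaler0.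
rewrite !dotA_subZ // -subr_ge0.
rewrite (_ : _ - _ = (t - dotA A e p / dotA A p p) ^+ 2 * dotA A p p).
  by rewrite mulr_ge0 ?sqr_ge0 // ltW.
by field; rewrite gt_eqF.
Qed.

(** By Pythagoras the extra component [q] costs [t^2 |q|_A^2] and gains
    nothing. *)
Lemma conjugate_direction_better e p q t :
  dotA A e q = 0 -> dotA A p q = 0 ->
  dotA A (e - t *: p) (e - t *: p)
    <= dotA A (e - t *: (p + q)) (e - t *: (p + q)).
Proof.
have [AE _] := (spdP A).1 spdA => eq0 pq0.
rewrite !dotA_subZ // !dotADr !dotADl eq0 (dotAC q p AE) pq0 !addr0 add0r.
by rewrite lerD2l ler_wpM2l ?sqr_ge0 // lerDl spd_ge0.
Qed.
End Descent.

(** * The truncated conjugate gradient recurrence *)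

Section PCG.
Variables (R : realType) (n : nat) (A : 'M[R]_n) (b x0 : 'cV[R]_n).
Variables (B : nat -> 'M[R]_n) (m : nat -> nat) (x r s p : nat -> 'cV[R]_n).
Hypotheses (spdA : spd A) (m_step : forall k, (m k.+1 <= m k + 1)%N).
Hypothesis run : pcg A b B m x0 x r s p.

Lemma dotA_swap u v : dot (A *m u) v = dotA A v u.
Proof. by rewrite dotC. Qed.

(** Holds also for [p l = 0], where the denominator vanishes; so the
    orthogonality relations below hold at every index, even past the exact
    solution. *)
Lemma direction_coefK u l :
  dot u (p l) / dot (A *m p l) (p l) * dotA A (p l) (p l) = dot u (p l).
Proof.
have [_ Apos] := (spdP A).1 spdA.
have [->|/Apos pp] := eqVneq (p l) 0; first by rewrite dotA0l mulr0 dotC dot0l.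
by rewrite dotA_swap divfK // gt_eqF.
Qed.

(** Everything in the window of [k+1] other than [k] was already in the window of
    [k], so the retained directions are mutually conjugate by induction and the
    Gram-Schmidt sum then removes the component along each of them. *)
Lemma directions_conjugate k i j :
  (k - m k <= i)%N -> (i < j <= k)%N -> dotA A (p i) (p j) = 0.
Proof.
have [AE _] := (spdP A).1 spdA.
elim: k i j => [|k IH] i j; first by lia.
move=> ki /andP[ij]; have mk := m_step k.
rewrite leq_eqVlt ltnS => /orP[/eqP jk|jk]; last by apply: IH; lia.
rewrite {}jk in ij *; rewrite (pcg_direction run k.+1) dotABr dotA_sumr.
rewrite (bigD1_seq i) /= ?iota_uniq ?mem_index_iota ?ki //.
rewrite big1_seq => [|l /andP[li]]; last first.
  rewrite mem_index_iota => /andP[kl lk]; rewrite dotAZr.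
  case: (ltngtP l i) => [l_i|i_l|lE]; last by rewrite lE eqxx in li.
    by rewrite dotAC // IH ?mulr0 //; lia.
  by rewrite IH ?mulr0 //; lia.
by rewrite addr0 dotAZr direction_coefK dotA_swap subrr.
Qed.

(** The line search removes the component along [p k], and conjugacy keeps the
    components along older retained directions at zero. *)
Lemma residual_orthogonal k l :
  (k - m k <= l < k)%N -> dot (r k) (p l) = 0.
Proof.
elim: k l => [|k IH] l; first by rewrite ltn0 andbF.
move=> /andP[kl lk]; have mk := m_step k.
rewrite (pcg_residual run) (pcg_update run) mulmxDr opprD addrA.
rewrite -(pcg_residual run) -scalemxAr -scaleNr dotDl dotZl (dotA_swap (p k) (p l)).
move: lk; rewrite ltnS leq_eqVlt => /orP[/eqP ->|lk].
  by rewrite mulNr direction_coefK subrr.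
by rewrite IH ?(@directions_conjugate k l k) ?mulr0 ?addr0 //; lia.
Qed.

Lemma residual_error k : A *m (invmx A *m b - x k) = r k.
Proof.
by rewrite mulmxBr mulKVmx ?spd_unitmx // (pcg_residual run).
Qed.

(** Comparison with a step along the preconditioned residual [s k]: since [t] is
    free, the bound for preconditioned steepest descent carries over to every
    choice of windows. *)
Lemma error_energy_descent k t (e := fun j => invmx A *m b - x j) :
  dotA A (e k.+1) (e k.+1) <= dotA A (e k - t *: s k) (e k - t *: s k).
Proof.
have [AE _] := (spdP A).1 spdA.
have ep u : dotA A (e k) u = dot (r k) u by rewrite dotAC // -residual_error dotC.
pose q := s k - p k.
have qE : q = \sum_(k - m k <= l < k)
    (dot (A *m s k) (p l) / dot (A *m p l) (p l)) *: p l.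
  by rewrite /q (pcg_direction run k) opprB addrC subrK.
have eq0 : dotA A (e k) q = 0.
  rewrite qE dotA_sumr big1_seq // => l /andP[_]; rewrite mem_index_iota => kl.
  by rewrite dotAZr ep residual_orthogonal // mulr0.
have pq0 : dotA A (p k) q = 0.
  rewrite qE dotA_sumr big1_seq // => l /andP[_]; rewrite mem_index_iota.
  move=> /andP[kl lk].
  by rewrite dotAZr dotAC // (@directions_conjugate k) ?mulr0 // lk /=.
have -> : e k.+1 = e k - (dotA A (e k) (p k) / dotA A (p k) (p k)) *: p k.
  by rewrite /e (pcg_update run) opprD addrA ep dotA_swap.
have -> : s k = p k + q by rewrite addrC subrK.
exact: le_trans (exact_line_search spdA _ _ t)
                (conjugate_direction_better spdA t eq0 pq0).
Qed.
End PCG.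

Theorem theorem4p2 (R : realType) (n : nat) (A : 'M[R]_n)
    (B : nat -> 'M[R]_n) (kappa_max : R) (m : nat -> nat)
    (b x0 : 'cV[R]_n) (x r s p : nat -> 'cV[R]_n)
    (spdA : spd A) (spdB : forall k : nat, spd (B k))
    (kappaB : forall k : nat, cond_number (invmx (B k) *m A) <= kappa_max)
    (m_le : forall k : nat, (m k <= k)%N)
    (m_step : forall k : nat, (m k.+1 <= m k + 1)%N)
    (run : pcg A b B m x0 x r s p) :
  let sol := invmx A *m b in
  let e := fun k : nat => sol - x k in
  forall k : nat, (forall j : nat, (j <= k)%N -> x j <> sol) ->
    normA A (e k.+1) / normA A (e k) <= (kappa_max - 1) / (kappa_max + 1).
Proof.
move=> sol e k not_solved.
have eN0 : e k != 0 by rewrite subr_eq0 eq_sym; apply/eqP/not_solved.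
have [t [rho [kappa_ge1 rhoE contr]]] :=
  preconditioned_step_contraction spdA (spdB k) eN0.
have := kappaB k; move: kappa_ge1 rhoE.
move: (cond_number _) => kappa kappa_ge1 rhoE kappa_le.
have rho_ge0 : 0 <= rho by rewrite rhoE; apply: divr_ge0; lra.
apply: le_trans (_ : rho <= _); last first.
  (* Monotonicity of [kappa |-> (kappa - 1) / (kappa + 1)]. *)
  rewrite rhoE ler_pdivrMr; last by lra.
  rewrite mulrAC ler_pdivlMr; last by lra.
  nra.
have ee : 0 < dotA A (e k) (e k) by exact: ((spdP A).1 spdA).2.
rewrite ler_pdivrMr ?sqrtr_gt0 // /normA -[rho]ger0_norm // -sqrtr_sqr.
rewrite -sqrtrM ?sqr_ge0 // ler_wsqrtr //; apply: le_trans contr.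
rewrite -mulmxA (residual_error spdA run) -(pcg_precond run).
exact: error_energy_descent spdA m_step run k t.
Qed.
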